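(* Let $((\mathcal{A}_t)_{t\in[0,1]},\Theta)$ be a continuous field of $C^*$-algebras, trivial away from $0$ (that is, trivial on $(0,1]$). If $\mathcal{A}_t$ is stably finite for $t\in(0,1]$, then $\mathcal{A}_0$ is stably finite.
   Context: Continuous fields of $C^*$-algebras are understood in the sense of Dixmier, $\Theta$ being the space of continuous sections. A $C^*$-algebra $\mathcal{A}$ with unitization $\widetilde{\mathcal{A}}=\mathbb{C}\mathbf{1}\dotplus\mathcal{A}$ is stably finite if for every $r\ge1$, every $v\in M_r(\widetilde{\mathcal{A}})$ with $vv^*=\mathbf{1}_r$ satisfies $v^*v=\mathbf{1}_r$. *)

(* Defs.v *)
From HB Require Import structures.
From mathcomp Require Import all_boot all_order all_algebra.
From mathcomp Require Import all_classical all_reals all_analysis.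
From mathcomp Require Import complex ring.

Set Implicit Arguments.
Unset Strict Implicit.
Unset Printing Implicit Defensive.

Import Order.TTheory GRing.Theory Num.Theory.
Import numFieldNormedType.Exports.

Local Open Scope classical_set_scope.
Local Open Scope ring_scope.
Local Open Scope complex_scope.

(* C*-algebras are not assumed to be unital, hence not built on the ring
   hierarchy, which requires a unit. *)
HB.mixin Record CompleteNormedModule_isCStarAlgebra (R : realType) A
    of CompleteNormedModule R[i] A := {
  cmul : A -> A -> A ;
  cstar : A -> A ;
  cmulA : associative cmul ;
  cmulDl : forall a b c : A, cmul (a + b) c = cmul a c + cmul b c ;
  cmulDr : forall a b c : A, cmul a (b + c) = cmul a b + cmul a c ;
  cmulZl : forall (k : R[i]) (a b : A), cmul (k *: a) b = k *: cmul a b ;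
  cmulZr : forall (k : R[i]) (a b : A), cmul a (k *: b) = k *: cmul a b ;
  cstarK : involutive cstar ;
  cstarD : forall a b : A, cstar (a + b) = cstar a + cstar b ;
  cstarZ : forall (k : R[i]) (a : A), cstar (k *: a) = k^* *: cstar a ;
  cstarM : forall a b : A, cstar (cmul a b) = cmul (cstar b) (cstar a) ;
  cnormM : forall a b : A, `|cmul a b| <= `|a| * `|b| ;
  cnorm_star : forall a : A, `|cmul (cstar a) a| = `|a| ^+ 2
}.

#[short(type="cstarAlgType")]
HB.structure Definition CStarAlgebra (R : realType) :=
  {A of CompleteNormedModule_isCStarAlgebra R A & CompleteNormedModule R[i] A}.

Section Unitization.
Context (R : realType) (A : cstarAlgType R).

(* The pair (l, a) stands for l 1 + a; a new unit is adjoined even when A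
   already has one. *)
Definition unitization : Type := (R[i] * A)%type.

HB.instance Definition _ := GRing.Zmodule.on unitization.

Definition unitization_one : unitization := (1, 0).

Definition unitization_mul (x y : unitization) : unitization :=
  (x.1 * y.1, x.1 *: y.2 + y.1 *: x.2 + cmul x.2 y.2).

Definition unitization_star (x : unitization) : unitization :=
  (x.1^*, cstar x.2).

Lemma cmul0l (a : A) : cmul 0 a = 0.
Proof. by rewrite -[X in cmul X _](scale0r (0 : A)) cmulZl scale0r. Qed.

Lemma cmul0r (a : A) : cmul a 0 = 0.
Proof. by rewrite -[X in cmul _ X](scale0r (0 : A)) cmulZr scale0r. Qed.

Fact unitization_mulA : associative unitization_mul.
Proof.
move=> [k a] [l b] [m c]; rewrite /unitization_mul /=; apply: (congr2 pair).
  exact: mulrA.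
rewrite !scalerDr !cmulDl !cmulDr !cmulZl !cmulZr !scalerA cmulA.
rewrite (mulrC m k) (mulrC m l) -!addrA; congr (_ + (_ + _)).
rewrite addrCA; congr (_ + _).
by rewrite [RHS]addrCA; congr (_ + _); rewrite addrCA.
Qed.

Fact unitization_mul1l : left_id unitization_one unitization_mul.
Proof.
case=> k a; rewrite /unitization_mul /=; apply: (congr2 pair); first exact: mul1r.
by rewrite scale1r scaler0 addr0 cmul0l addr0.
Qed.

Fact unitization_mul1r : right_id unitization_one unitization_mul.
Proof.
case=> k a; rewrite /unitization_mul /=; apply: (congr2 pair); first exact: mulr1.
by rewrite scale1r scaler0 add0r cmul0r addr0.
Qed.

Fact unitization_mulDl : left_distributive unitization_mul +%R.
Proof.
move=> [k a] [l b] [m c]; rewrite /unitization_mul /=; apply: (congr2 pair).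
  exact: mulrDl.
rewrite scalerDl scalerDr cmulDl [RHS]addrACA; congr (_ + _).
exact: addrACA.
Qed.

Fact unitization_mulDr : right_distributive unitization_mul +%R.
Proof.
move=> [k a] [l b] [m c]; rewrite /unitization_mul /=; apply: (congr2 pair).
  exact: mulrDr.
rewrite scalerDl scalerDr cmulDr [RHS]addrACA; congr (_ + _).
exact: addrACA.
Qed.

Fact unitization_oner_neq0 : unitization_one != 0.
Proof. by apply/negP => /eqP[] /eqP; rewrite oner_eq0. Qed.

HB.instance Definition _ := GRing.Zmodule_isNzRing.Build unitization
  unitization_mulA unitization_mul1l unitization_mul1r
  unitization_mulDl unitization_mulDr unitization_oner_neq0.

Definition mx_adjoint (r : nat) (v : 'M[unitization]_r) : 'M[unitization]_r :=
  (map_mx unitization_star v)^T.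

Definition stably_finite : Prop :=
  forall (r : nat) (v : 'M[unitization]_r), (1 <= r)%N ->
    v *m mx_adjoint v = 1%:M -> mx_adjoint v *m v = 1%:M.

End Unitization.

(* Norms take values in R[i], where 0 < e forces e to be real; complex.Re `|a|
   is the norm of a as an element of R. *)
Definition locally_approximable (R : realType) (T : topologicalType)
    (A : T -> cstarAlgType R) (Theta : set (forall t, A t)) :
    set (forall t, A t) :=
  [set x | forall (t : T) (e : R[i]), 0 < e ->
     exists2 x', Theta x' & \forall s \near t, `|x s - x' s| <= e].

(* Dixmier, C*-algebras, 10.1.2 and 10.3.1. *)
Record is_continuous_field (R : realType) (T : topologicalType)
    (A : T -> cstarAlgType R) (Theta : set (forall t, A t)) : Prop := {
  cfield0 : Theta (fun t => 0) ;
  cfieldD : forall x y, Theta x -> Theta y -> Theta (fun t => x t + y t) ;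
  cfieldZ : forall (k : R[i]) x, Theta x -> Theta (fun t => k *: x t) ;
  cfieldM : forall x y, Theta x -> Theta y -> Theta (fun t => cmul (x t) (y t)) ;
  cfield_star : forall x, Theta x -> Theta (fun t => cstar (x t)) ;
  cfield_dense : forall t, dense [set x t | x in Theta] ;
  cfield_norm : forall x, Theta x ->
    continuous (fun t => complex.Re `|x t| : R) ;
  cfield_local : locally_approximable Theta `<=` Theta
}.

Record continuous_field (R : realType) (T : topologicalType) := ContinuousField {
  fiber : T -> cstarAlgType R ;
  sections : set (forall t, fiber t) ;
  continuous_fieldP : is_continuous_field sections
}.

Arguments fiber {R T}.
Arguments sections {R T}.

Definition is_star_isomorphism (R : realType) (A B : cstarAlgType R)
    (f : A -> B) : Prop :=
  [/\ (forall (k : R[i]) (a b : A), f (k *: a + b) = k *: f a + f b),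
      (forall a b : A, f (cmul a b) = cmul (f a) (f b)),
      (forall a : A, f (cstar a) = cstar (f a)) &
      bijective f].

Definition field_isomorphic (R : realType) (T : topologicalType)
    (E F : continuous_field R T) : Prop :=
  exists f : forall t, fiber E t -> fiber F t,
    (forall t, is_star_isomorphism (f t)) /\
    (forall x : forall t, fiber E t,
       sections E x <-> sections F (fun t => f t (x t))).

Lemma cnormE (R : realType) (A : cstarAlgType R) (a : A) :
  `|a| = (complex.Re `|a|)%:C.
Proof. by rewrite RRe_real // normr_real. Qed.

Lemma cnorm_cstar (R : realType) (A : cstarAlgType R) (a : A) :
  `|cstar a| = `|a|.
Proof.
have le_star (b : A) : `|b| <= `|cstar b|.
  have [->|b0] := eqVneq b 0; first by rewrite normr0.
  rewrite -(ler_pM2r (x := `|b|)) ?normr_gt0 // -expr2 -cnorm_star.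
  exact: cnormM.
apply/le_anti; rewrite le_star andbT.
by have := le_star (cstar a); rewrite cstarK.
Qed.

Lemma cstarB (R : realType) (A : cstarAlgType R) (a b : A) :
  cstar (a - b) = cstar a - cstar b.
Proof. by rewrite cstarD -scaleN1r cstarZ rmorphN1 scaleN1r. Qed.

Lemma cmulBl (R : realType) (A : cstarAlgType R) (a b c : A) :
  cmul (a - b) c = cmul a c - cmul b c.
Proof. by rewrite cmulDl -scaleN1r cmulZl scaleN1r. Qed.

Lemma cmulBr (R : realType) (A : cstarAlgType R) (a b c : A) :
  cmul a (b - c) = cmul a b - cmul a c.
Proof. by rewrite cmulDr -scaleN1r cmulZr scaleN1r. Qed.

Lemma Re_cnormD (R : realType) (A : cstarAlgType R) (a b : A) :
  complex.Re `|a + b| <= complex.Re `|a| + complex.Re `|b| :> R.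
Proof. by rewrite -lecR rmorphD /= -!cnormE ler_normD. Qed.

Lemma Re_cnorm_dist (R : realType) (A : cstarAlgType R) (a b : A) :
  `|complex.Re `|a| - complex.Re `|b| : R| <= complex.Re `|a - b|.
Proof.
rewrite ler_norml lerBlDr lerBrDr addrC lerBlDr; apply/andP; split.
  by rewrite addrC distrC; have := Re_cnormD (b - a) a; rewrite subrK.
by have := Re_cnormD (a - b) b; rewrite subrK.
Qed.

Section LocalCompletion.
Context (R : realType) (T : topologicalType) (A : T -> cstarAlgType R).
Context (Theta : set (forall t, A t)).
Context (Theta0 : Theta (fun t => 0)).
Context (ThetaD :
  forall x y, Theta x -> Theta y -> Theta (fun t => x t + y t)).
Context (ThetaZ :
  forall (k : R[i]) x, Theta x -> Theta (fun t => k *: x t)).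
Context (ThetaM :
  forall x y, Theta x -> Theta y -> Theta (fun t => cmul (x t) (y t))).
Context (Theta_star : forall x, Theta x -> Theta (fun t => cstar (x t))).
Context (Theta_dense : forall t, dense [set x t | x in Theta]).
Context (Theta_norm :
  forall x, Theta x -> continuous (fun t => complex.Re `|x t| : R)).

Lemma Theta_locally_bounded x t : Theta x ->
  \forall s \near t, `|x s| <= `|x t| + 1.
Proof.
move=> /Theta_norm /(_ t) /cvgr_dist_le /(_ 1 ltr01).
apply: filterS => s; rewrite distrC => /ler_normlW; rewrite lerBlDl => h.
by rewrite (cnormE (x s)) (cnormE (x t)) -(rmorph1 (real_complex R)) -rmorphD lecR.
Qed.

Lemma sub_locally_approximable : Theta `<=` locally_approximable Theta.
Proof.
move=> x Thx t e e0; exists x => //; apply: nearW => s.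
by rewrite subrr normr0 ltW.
Qed.

Lemma locally_approximable_is_continuous_field :
  is_continuous_field (locally_approximable Theta).
Proof.
split.
- exact: sub_locally_approximable.
- move=> x y lx ly t e e0; have e20 : 0 < e / 2 by rewrite divr_gt0.
  have [x' Thx' nx] := lx t _ e20; have [y' Thy' ny] := ly t _ e20.
  exists (fun t => x' t + y' t); first exact: ThetaD.
  apply: filterS2 nx ny => s hx hy.
  rewrite opprD addrACA (le_trans (ler_normD _ _)) //.
  by rewrite [leRHS](splitr e) lerD.
- move=> k x lx t e e0.
  have k0 : 0 < `|k| + 1 by rewrite ltr_wpDl.
  have [x' Thx' nx] := lx t _ (divr_gt0 e0 k0).
  exists (fun t => k *: x' t); first exact: ThetaZ.
  apply: filterS nx => s hx; rewrite -scalerBr normrZ.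
  rewrite ler_pdivlMr // in hx; rewrite mulrC (le_trans _ hx) //.
  by rewrite ler_wpM2l // lerDl.
- move=> x y lx ly t e e0; have e20 : 0 < e / 2 by rewrite divr_gt0.
  have [y1 Thy1 ny1] := ly t 1 ltr01.
  have N0 : 0 < `|y1 t| + 1 + 1 by rewrite ltr_wpDl // addr_ge0.
  have [x' Thx' nx] := lx t _ (divr_gt0 e20 N0).
  have K0 : 0 < `|x' t| + 1 by rewrite ltr_wpDl.
  have [y' Thy' ny] := ly t _ (divr_gt0 e20 K0).
  exists (fun t => cmul (x' t) (y' t)); first exact: ThetaM.
  have nyb : \forall s \near t, `|y s| <= `|y1 t| + 1 + 1.
    apply: filterS2 ny1 (Theta_locally_bounded t Thy1) => s h1 h2.
    have := ler_normD (y s - y1 s) (y1 s); rewrite subrK => /le_trans; apply.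
    by rewrite addrC lerD.
  have nxb := Theta_locally_bounded t Thx'.
  apply: filterS2 (filterI nx nyb) (filterI ny nxb) => s [hx hyb] [hy hxb].
  have -> : cmul (x s) (y s) - cmul (x' s) (y' s) =
      cmul (x s - x' s) (y s) + cmul (x' s) (y s - y' s).
    by rewrite cmulBl cmulBr addrA subrK.
  rewrite (le_trans (ler_normD _ _)) // [leRHS](splitr e) lerD //.
    rewrite (le_trans (cnormM _ _)) // -[leRHS](divfK (lt0r_neq0 N0)).
    by rewrite ler_pM.
  rewrite (le_trans (cnormM _ _)) // -[leRHS](divfK (lt0r_neq0 K0)) mulrC.
  by rewrite ler_pM.
- move=> x lx t e e0; have [x' Thx' nx] := lx t e e0.
  exists (fun t => cstar (x' t)); first exact: Theta_star.
  by apply: filterS nx => s; rewrite -cstarB cnorm_cstar.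
- move=> t U U0 oU; have [_ [/[swap] -[x Thx <-] Ux]] := Theta_dense U0 oU.
  exists (x t); split=> //; exists x => //.
  exact: sub_locally_approximable.
- move=> x lx t; apply/cvgrPdist_le => e e0.
  have e30 : 0 < (e / 3)%:C by rewrite (ltcR 0) divr_gt0.
  have [x' Thx' nx] := lx t _ e30.
  have cx' : {for t, continuous (fun s => complex.Re `|x' s| : R)}.
    exact: Theta_norm.
  move: cx' => /cvgr_dist_le.
  have e30' : 0 < e / 3 by rewrite divr_gt0.
  move=> /(_ _ e30'); have hxt := nbhs_singleton nx.
  apply: filterS2 nx => s hxs hs.
  rewrite cnormE lecR in hxt; rewrite cnormE lecR in hxs.
  have := Re_cnorm_dist (x t) (x' t); have := Re_cnorm_dist (x' s) (x s).
  rewrite (distrC (x' s)) => h1 h2.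
  have -> : e = e / 3 + e / 3 + e / 3 by field.
  apply: le_trans (ler_distD (complex.Re `|x' s|) _ _) _.
  rewrite lerD //; last exact: le_trans h1 hxs.
  apply: le_trans (ler_distD (complex.Re `|x' t|) _ _) _.
  by rewrite lerD //; exact: le_trans h2 hxt.
- move=> x lx t e e0; have e20 : 0 < e / 2 by rewrite divr_gt0.
  have [y ly ny] := lx t _ e20; have [z Thz nz] := ly t _ e20.
  exists z => //; apply: filterS2 ny nz => s h1 h2.
  by rewrite (le_trans (ler_distD (y s) _ _)) // [leRHS](splitr e) lerD.
Qed.

End LocalCompletion.

Section ConstantField.
Context (R : realType) (T : topologicalType) (A : cstarAlgType R).

Definition constant_sections : set (T -> A) := [set x | continuous x].

Lemma constant_sectionsE : constant_sections =
  @locally_approximable R T (fun=> A) (range (fun (a : A) (_ : T) => a)).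
Proof.
apply/seteqP; split=> x /= hx.
  move=> t e e0; exists (fun=> x t); first by exists (x t).
  have /cvgr_dist_le /(_ e e0) := hx t.
  by apply: filterS => s; rewrite distrC.
move=> t; apply/cvgrPdist_le => e e0; have e20 : 0 < e / 2 by rewrite divr_gt0.
have [_ [a _ <-] na] := hx t _ e20; have hat := nbhs_singleton na.
apply: filterS na => s hs.
rewrite (le_trans (ler_distD a _ _)) // [leRHS](splitr e) lerD //.
by rewrite distrC.
Qed.

Fact constant_is_continuous_field :
  @is_continuous_field R T (fun=> A) constant_sections.
Proof.
rewrite constant_sectionsE; apply: locally_approximable_is_continuous_field.
- by exists 0.
- by move=> _ _ [a _ <-] [b _ <-]; exists (a + b).
- by move=> k _ [a _ <-]; exists (k *: a).
- by move=> _ _ [a _ <-] [b _ <-]; exists (cmul a b).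
- by move=> _ [a _ <-]; exists (cstar a).
- by move=> t U [a Ua] _; exists a; split=> //; exists (fun=> a) => //; exists a.
- by move=> _ [a _ <-] t; exact: cvg_cst.
Qed.

Definition constant_field : continuous_field R T :=
  ContinuousField constant_is_continuous_field.

End ConstantField.

Section RestrictedField.
Context (R : realType) (T : topologicalType) (F : continuous_field R T).
Context (Y : set T).

Definition restrict_section (x : forall t, fiber F t) :
  forall y : set_type Y, fiber F (set_val y) := fun y => x (set_val y).

(* Following Dixmier, 10.1: a section over Y is only locally, up to e, the restriction
   of a section over T, and need not extend to T. *)
Definition restricted_sections :
    set (forall y : set_type Y, fiber F (set_val y)) :=
  locally_approximable [set restrict_section x | x in sections F].

Fact restricted_is_continuous_field :
  is_continuous_field restricted_sections.
Proof.
have FP := continuous_fieldP F.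
apply: locally_approximable_is_continuous_field.
- by exists (fun=> 0) => //; exact: cfield0 FP.
- move=> _ _ [x Fx <-] [y Fy <-]; exists (fun t => x t + y t) => //.
  exact: cfieldD.
- move=> k _ [x Fx <-]; exists (fun t => k *: x t) => //; exact: cfieldZ.
- move=> _ _ [x Fx <-] [y Fy <-]; exists (fun t => cmul (x t) (y t)) => //.
  exact: cfieldM.
- move=> _ [x Fx <-]; exists (fun t => cstar (x t)) => //; exact: cfield_star.
- move=> y U U0 oU.
  have [_ [/[swap] -[x Fx <-] Ux]] := cfield_dense FP U0 oU.
  by exists (x (set_val y)); split=> //; exists (restrict_section x) => //; exists x.
- move=> _ [x Fx <-] y.
  apply: (@continuous_comp _ _ _ (set_val : set_type Y -> T)
    (fun t => complex.Re `|x t|)).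
    exact: initial_continuous.
  by apply: cfield_norm FP _ Fx _.
Qed.

Definition restricted_field : continuous_field R (set_type Y) :=
  ContinuousField restricted_is_continuous_field.

End RestrictedField.

Definition trivial_on (R : realType) (T : topologicalType)
    (F : continuous_field R T) (Y : set T) : Prop :=
  exists A : cstarAlgType R,
    field_isomorphic (restricted_field F Y) (constant_field (set_type Y) A).

Definition unit_interval (R : realType) : topologicalType :=
  set_type (`[0, 1]%classic : set R).

Fact unit_interval_zero_subproof (R : realType) :
  (0 : R) \in (`[0, 1]%classic : set R).
Proof. by rewrite inE /= in_itv /= lexx ler01. Qed.

Definition unit_interval_zero (R : realType) : unit_interval R :=
  exist _ 0 (unit_interval_zero_subproof R).

(* Main.v *)
(* Lift v with v v^* = 1 over the fiber at 0 approximately to a matrix W of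
   sections with the same scalar part, and put d := W W^* - 1, which is small at
   0, hence at every t close to 0 by continuity of the norm. In the fiber at one
   such t > 0, a contraction argument gives a small self-adjoint e such that
   (1 + e) (1 + d) (1 + e) = 1, i.e. 1 + e = (1 + d)^(-1/2); thus
   u := (1 + e) W satisfies u u^* = 1, so stable finiteness yields
   W^* (1 + e)^2 W = u^* u = 1, and W^* W - 1 is small at t. By continuity it is
   small at 0, and so is v^* v - 1.
   No C*-norm on matrices is needed: all the estimates are made with the
   entrywise l^1 norm, which is submultiplicative. *)
Require Import Defs.
From mathcomp Require Import all_boot all_order all_algebra.
From mathcomp Require Import all_classical all_reals all_analysis.
From mathcomp Require Import complex ring lra.

Set Implicit Arguments.
Unset Strict Implicit.
Unset Printing Implicit Defensive.

Import Order.TTheory GRing.Theory Num.Theory.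
Import numFieldNormedType.Exports.
Local Open Scope classical_set_scope.
Local Open Scope ring_scope.
Local Open Scope complex_scope.

Lemma real_complexD (R : realType) (a b : R) : (a + b)%:C = a%:C + b%:C.
Proof. exact: (rmorphD (real_complex R)). Qed.

Lemma real_complexM (R : realType) (a b : R) : (a * b)%:C = a%:C * b%:C.
Proof. exact: (rmorphM (real_complex R)). Qed.

Section UnitizationNorm.
Context (R : realType) (A : cstarAlgType R).
Local Notation U := (unitization A).

Definition unorm (x : U) : R := complex.Re `|x.1| + complex.Re `|x.2|.
(* Otherwise /= turns the norm of R[i] into a square root. *)
Arguments unorm : simpl never.

Lemma unormE (x : U) : (unorm x)%:C = `|x.1| + `|x.2|.
Proof.
by rewrite [LHS]real_complexD; congr (_ + _);
  apply: RRe_real; exact: normr_real.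
Qed.

Lemma unorm_ge0 (x : U) : 0 <= unorm x.
Proof. by rewrite -lecR unormE; apply: addr_ge0. Qed.

Lemma unorm0 : unorm (0 : U) = 0.
Proof. by rewrite /unorm !normr0 addr0. Qed.

Lemma unorm_eq0 (x : U) : unorm x = 0 -> x = 0.
Proof.
case: x => k a xE; have := unormE (k, a); rewrite xE /= => /esym/eqP.
rewrite paddr_eq0 // !normr_eq0 => /andP[/eqP -> /eqP ->]; reflexivity.
Qed.

Lemma unormD (x y : U) : unorm (x + y) <= unorm x + unorm y.
Proof.
rewrite -lecR [leRHS]real_complexD !unormE addrACA.
by rewrite lerD // ler_normD.
Qed.

Lemma unormN (x : U) : unorm (- x) = unorm x.
Proof. by rewrite /unorm !normrN. Qed.

Lemma unormM (x y : U) : unorm (x * y) <= unorm x * unorm y.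
Proof.
rewrite -lecR [leRHS]real_complexM !unormE normrM mulrDl !mulrDr -!addrA lerD2l.
rewrite (le_trans (ler_normD _ _)) // addrA lerD ?cnormM //.
by rewrite (le_trans (ler_normD _ _)) // !normrZ lerD // mulrC.
Qed.

Lemma unorm_star (x : U) : unorm (unitization_star x) = unorm x.
Proof.
congr (complex.Re _ + complex.Re _); last exact: cnorm_cstar.
exact: norm_conjC.
Qed.

Lemma unitization_starD (x y : U) :
  unitization_star (x + y) = unitization_star x + unitization_star y.
Proof. by rewrite /unitization_star /= rmorphD cstarD. Qed.

Lemma unitization_starM (x y : U) :
  unitization_star (x * y) = unitization_star y * unitization_star x.
Proof.
case: x y => [k a] [l b]; rewrite /unitization_star /=; apply: (congr2 pair) => /=.
  by rewrite rmorphM mulrC.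
rewrite !cstarD !cstarZ cstarM; congr (_ + _); exact: addrC.
Qed.

Lemma unitization_starK : involutive (@unitization_star R A).
Proof. by case=> k a; rewrite /unitization_star /= cstarK conjcK. Qed.

Definition uhalf (x : U) : U := (2^-1 * x.1, 2^-1 *: x.2).

Lemma uhalfK (x : U) : uhalf x + uhalf x = x.
Proof.
have h1 : 2^-1 + 2^-1 = 1 :> R[i] by rewrite [RHS](splitr 1) mul1r.
case: x => k a; apply: (congr2 pair) => /=; first by rewrite -mulrDl h1 mul1r.
by rewrite -scalerDl h1 scale1r.
Qed.

Lemma uhalfB (x y : U) : uhalf (x - y) = uhalf x - uhalf y.
Proof.
by case: x y => k a [l b]; apply: (congr2 pair); [exact: mulrBr|exact: scalerBr].
Qed.

Lemma unorm_half (x : U) : unorm (uhalf x) = unorm x / 2.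
Proof.
have h : `|2^-1 : R[i]| = (2^-1)%:C.
  rewrite normfV normr_nat -(rmorph_nat (real_complex R)).
  by rewrite -(fmorphV (real_complex R)).
apply: complexI; rewrite unormE real_complexM unormE /= normrM normrZ.
by rewrite -mulrDr h mulrC.
Qed.

Lemma uhalf_star (x : U) : unitization_star (uhalf x) = uhalf (unitization_star x).
Proof.
have h : (2^-1 : R[i])^* = 2^-1 by rewrite fmorphV rmorph_nat.
case: x => k a; apply: (congr2 pair) => /=.
  by rewrite -[in RHS]h; exact: rmorphM.
by rewrite cstarZ; congr (_ *: _); exact: h.
Qed.

End UnitizationNorm.

Section MatrixNorm.
Context (R : realType) (A : cstarAlgType R) (r : nat).
Local Notation U := (unitization A).
Local Notation M := 'M[U]_r.
Implicit Types x y : M.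

Definition mxnorm1 x : R := \sum_i \sum_j unorm (x i j).

Lemma mxnorm1_ge0 x : 0 <= mxnorm1 x.
Proof. by apply: sumr_ge0 => i _; apply: sumr_ge0 => j _; exact: unorm_ge0. Qed.

Lemma unorm_le_mxnorm1 x i j : unorm (x i j) <= mxnorm1 x.
Proof.
rewrite /mxnorm1 (bigD1 i) //= (bigD1 j) //= -addrA lerDl addr_ge0 ?sumr_ge0 //.
  by move=> k _; exact: unorm_ge0.
by move=> k _; apply: sumr_ge0 => l _; exact: unorm_ge0.
Qed.

Lemma mxnorm1_eq0 x : mxnorm1 x <= 0 -> x = 0.
Proof.
move=> x0; apply/matrixP => i j; rewrite mxE; apply: unorm_eq0; apply/eqP.
by rewrite eq_le unorm_ge0 andbT (le_trans (unorm_le_mxnorm1 x i j)).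
Qed.

Lemma mxnorm1D x y : mxnorm1 (x + y) <= mxnorm1 x + mxnorm1 y.
Proof.
rewrite /mxnorm1 -big_split; apply: ler_sum => i _; rewrite -big_split.
by apply: ler_sum => j _; rewrite mxE unormD.
Qed.

Lemma mxnorm1N x : mxnorm1 (- x) = mxnorm1 x.
Proof. by apply: eq_bigr => i _; apply: eq_bigr => j _; rewrite mxE unormN. Qed.

Lemma mxnorm1B x y : mxnorm1 (x - y) = mxnorm1 (y - x).
Proof. by rewrite -mxnorm1N opprB. Qed.

Lemma mxnorm1M x y : mxnorm1 (x *m y) <= mxnorm1 x * mxnorm1 y.
Proof.
rewrite [leRHS]mulr_suml; apply: ler_sum => i _; rewrite mulr_suml.
have rowy k : \sum_j unorm (y k j) <= mxnorm1 y.
  rewrite [leRHS](bigD1 k) //= lerDl; apply: sumr_ge0 => l _.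
  by apply: sumr_ge0 => j _; exact: unorm_ge0.
have leM : \sum_j unorm ((x *m y) i j) <=
    \sum_j \sum_k unorm (x i k) * unorm (y k j).
  apply: ler_sum => j _; rewrite mxE.
  elim/big_ind2: _ => [|a b c d ab cd|k _]; first by rewrite unorm0.
    by rewrite (le_trans (unormD _ _)) // lerD.
  exact: unormM.
rewrite (le_trans leM) // exchange_big; apply: ler_sum => k _.
by rewrite -mulr_sumr ler_wpM2l // unorm_ge0.
Qed.

Lemma mxnorm1_adj x : mxnorm1 (mx_adjoint x) = mxnorm1 x.
Proof.
rewrite /mxnorm1 exchange_big; apply: eq_bigr => i _; apply: eq_bigr => j _.
by rewrite !mxE unorm_star.
Qed.

Lemma mx_adjointD x y : mx_adjoint (x + y) = mx_adjoint x + mx_adjoint y.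
Proof. by apply/matrixP => i j; rewrite !mxE unitization_starD. Qed.

Lemma mx_adjointK x : mx_adjoint (mx_adjoint x) = x.
Proof. by apply/matrixP => i j; rewrite !mxE unitization_starK. Qed.

Lemma unitization_star0 : unitization_star (0 : U) = 0.
Proof. by apply: unorm_eq0; rewrite unorm_star unorm0. Qed.

Lemma mx_adjointN x : mx_adjoint (- x) = - mx_adjoint x.
Proof.
apply/eqP; rewrite -subr_eq0 opprK -mx_adjointD addNr.
by apply/eqP/matrixP => i j; rewrite !mxE unitization_star0.
Qed.

Lemma mx_adjointM x y : mx_adjoint (x *m y) = mx_adjoint y *m mx_adjoint x.
Proof.
apply/matrixP => i j; rewrite !mxE.
rewrite (big_morph _ (@unitization_starD R A) unitization_star0).
by apply: eq_bigr => k _; rewrite !mxE unitization_starM.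
Qed.

Lemma mx_adjoint1 : mx_adjoint (1%:M : M) = 1%:M.
Proof.
rewrite -[LHS]mul1mx -{1}[1%:M]mx_adjointK -mx_adjointM.
by rewrite mul1mx mx_adjointK.
Qed.

Definition mxhalf x : M := map_mx (@uhalf R A) x.

Lemma mxhalfK x : mxhalf x + mxhalf x = x.
Proof. by apply/matrixP => i j; rewrite !mxE uhalfK. Qed.

Lemma mxhalfB x y : mxhalf (x - y) = mxhalf x - mxhalf y.
Proof. by apply/matrixP => i j; rewrite !mxE uhalfB. Qed.

Lemma mxnorm1_half x : mxnorm1 (mxhalf x) = mxnorm1 x / 2.
Proof.
rewrite /mxnorm1 mulr_suml; apply: eq_bigr => i _.
by rewrite mulr_suml; apply: eq_bigr => j _; rewrite mxE unorm_half.
Qed.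

Lemma mxhalf_adj x : mx_adjoint (mxhalf x) = mxhalf (mx_adjoint x).
Proof. by apply/matrixP => i j; rewrite !mxE uhalf_star. Qed.

End MatrixNorm.

Lemma half_exp_lt (R : realType) (K e : R) : 0 < e ->
  exists n, K * 2^-1 ^+ n < e.
Proof.
move=> e0; have h1 : `|2^-1 : R| < 1 by rewrite gtr0_norm ?invf_lt1 // ltr1n.
have /cvgrPdist_lt /(_ e e0) [n _ /(_ n (leqnn n))] := cvg_geometric K h1.
by rewrite sub0r normrN => /ltr_normlW h; exists n.
Qed.

Lemma le_half_exp (R : realType) (a b K : R) :
  (forall n, a <= b + K * 2^-1 ^+ n) -> a <= b.
Proof.
move=> h; apply/ler_addgt0Pr => e e0; have [n hn] := half_exp_lt K e0.
by rewrite (le_trans (h n)) // lerD2l ltW.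
Qed.

Lemma Re_norm_ge0 (R : realType) (V : normedZmodType R[i]) (a : V) :
  0 <= complex.Re `|a| :> R.
Proof. by have := normr_ge0 a; rewrite lecE => /andP[]. Qed.

Lemma cvg_geometric_increments (R : realType) (A : cstarAlgType R)
    (u : nat -> A) (C : R) :
  (forall n, complex.Re `|u n.+1 - u n| <= C * 2^-1 ^+ n) ->
  exists l, forall n, complex.Re `|u n - l| <= 2 * C * 2^-1 ^+ n.
Proof.
move=> hu.
have C0 : 0 <= C.
  have := hu 0%N; rewrite expr0 mulr1; apply: le_trans.
  exact: Re_norm_ge0.
have tail n m : complex.Re `|u (n + m)%N - u n| <=
    2 * C * (2^-1 ^+ n - 2^-1 ^+ (n + m)).
  elim: m => [|m IH]; first by rewrite addn0 !subrr normr0 mulr0.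
  have := Re_cnormD (u (n + m).+1 - u (n + m)%N) (u (n + m)%N - u n).
  rewrite addrA subrK addnS => /le_trans; apply.
  have -> : 2 * C * (2^-1 ^+ n - 2^-1 ^+ (n + m).+1) =
    C * 2^-1 ^+ (n + m) + 2 * C * (2^-1 ^+ n - 2^-1 ^+ (n + m)) :> R.
    by rewrite exprS; field.
  exact: lerD.
have dist n m : (n <= m)%N -> complex.Re `|u m - u n| <= 2 * C * 2^-1 ^+ n.
  move=> /subnKC <-; rewrite (le_trans (tail _ _)) // ler_wpM2l ?mulr_ge0 //.
  by rewrite gerBl exprn_ge0 // invr_ge0.
have : cvgn u.
  apply/cauchy_cvgP/cauchy_exP => e e0.
  have eE : e = (complex.Re e)%:C by rewrite RRe_real // gtr0_real.
  have e0' : 0 < complex.Re e by rewrite -ltcR -eE.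
  have [n hn] := half_exp_lt (2 * C) e0'.
  exists (u n), n => // m /= nm; rewrite -ball_normE /= distrC cnormE eE ltcR.
  by rewrite (le_lt_trans (dist _ _ nm)).
move=> /cvg_ex[l ul]; exists l => n.
apply/ler_addgt0Pr => e e0; have e0' : 0 < e%:C by rewrite (ltcR 0).
have /cvgrPdist_le /(_ _ e0') [m _ hm] := ul.
have h : `|l - u (n + m)%N| <= e%:C := hm _ (leq_addl _ _).
rewrite cnormE lecR in h.
have := Re_cnormD (u n - u (n + m)%N) (u (n + m)%N - l).
rewrite addrA subrK => /le_trans; apply.
rewrite lerD //; first by rewrite distrC dist // leq_addr.
by rewrite distrC.
Qed.

Lemma unorm_scalar_free (R : realType) (A : cstarAlgType R)
  (x : unitization A) : x.1 = 0 -> unorm x = complex.Re `|x.2|.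
Proof. by rewrite /unorm => ->; rewrite normr0 add0r. Qed.

Section InverseSquareRoot.
Context (R : realType) (A : cstarAlgType R) (r : nat).
Local Notation U := (unitization A).
Local Notation M := 'M[U]_r.
Implicit Types x y e d : M.

Definition scalar_part x : 'M[R[i]]_r := map_mx (fun u : U => u.1) x.

Lemma scalar_partD x y : scalar_part (x + y) = scalar_part x + scalar_part y.
Proof. by apply/matrixP => i j; rewrite !mxE. Qed.

Lemma scalar_partN x : scalar_part (- x) = - scalar_part x.
Proof. by apply/matrixP => i j; rewrite !mxE. Qed.

Lemma scalar_partM x y : scalar_part (x *m y) = scalar_part x *m scalar_part y.
Proof.
apply/matrixP => i j; rewrite !mxE.
rewrite (big_morph (fun u : U => u.1) (id1 := 0) (op1 := +%R)) //.
by apply: eq_bigr => k _; rewrite !mxE.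
Qed.

Lemma scalar_part1 : scalar_part 1%:M = 1%:M.
Proof. by apply/matrixP => i j; rewrite !mxE; case: (i == j). Qed.

Lemma scalar_part_adj x :
  scalar_part (mx_adjoint x) = (map_mx (@conjc R) (scalar_part x))^T.
Proof. by apply/matrixP => i j; rewrite !mxE. Qed.

Lemma scalar_part_half x : scalar_part (mxhalf x) = 2^-1 *: scalar_part x.
Proof. by apply/matrixP => i j; rewrite !mxE. Qed.

(* Restricted to zero scalar parts, so that only the completeness of A is used,
   not that of R[i]. *)
Lemma mxnorm1_cvg_geometric (x : nat -> M) (C : R) :
  (forall n, scalar_part (x n) = 0) ->
  (forall n, mxnorm1 (x n.+1 - x n) <= C * 2^-1 ^+ n) ->
  exists (l : M) (K : R), forall n, mxnorm1 (x n - l) <= K * 2^-1 ^+ n.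
Proof.
move=> x0 hx.
have /choice[l hl] (ij : 'I_r * 'I_r) : exists l : A, forall n,
    complex.Re `|(x n ij.1 ij.2).2 - l| <= 2 * C * 2^-1 ^+ n.
  apply: cvg_geometric_increments => n; apply: le_trans (hx n).
  apply: le_trans (unorm_le_mxnorm1 _ ij.1 ij.2).
  rewrite !mxE /unorm [leRHS]addrC lerDl; exact: Re_norm_ge0.
exists (\matrix_(i, j) ((0, l (i, j)) : U)), (\sum_(i < r) \sum_(j < r) 2 * C).
move=> n; rewrite /mxnorm1 mulr_suml; apply: ler_sum => i _.
rewrite mulr_suml; apply: ler_sum => j _; rewrite !mxE.
rewrite unorm_scalar_free; first exact: (hl (i, j)).
by rewrite [LHS]subr0; have /matrixP/(_ i j) := x0 n; rewrite !mxE.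
Qed.

(* The part of (1 + e) (1 + d) (1 + e) - 1 other than the linear term 2 e. *)
Definition sqrt_remainder d e := d + e *m e + e *m d + d *m e + e *m d *m e.

Lemma sqrt_remainderE d e :
  (1%:M + e) *m (1%:M + d) *m (1%:M + e) = 1%:M + (e + e + sqrt_remainder d e).
Proof.
rewrite /sqrt_remainder !(mulmxDl, mulmxDr, mul1mx, mulmx1) !addrA.
by rewrite [LHS](ACl (1*3*5*2*7*4*6*8)).
Qed.

Lemma sqrt_remainderB d e f :
  sqrt_remainder d e - sqrt_remainder d f =
  e *m (e - f) + (e - f) *m f + (e - f) *m d + d *m (e - f)
  + e *m d *m (e - f) + (e - f) *m d *m f.
Proof.
rewrite /sqrt_remainder !(mulmxBl, mulmxBr, mulmxDl, mulmxDr) !addrA.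
rewrite subrK subrK !opprD !addrA [LHS](ACl (1*6*2*7*3*8*4*9*5*10)).
by rewrite /= subrr add0r.
Qed.

Lemma mxnorm1D_le x y (s t : R) :
  mxnorm1 x <= s -> mxnorm1 y <= t -> mxnorm1 (x + y) <= s + t.
Proof. by move=> xs yt; rewrite (le_trans (mxnorm1D _ _)) // lerD. Qed.

Lemma mxnorm1M_le x y (s t : R) :
  mxnorm1 x <= s -> mxnorm1 y <= t -> mxnorm1 (x *m y) <= s * t.
Proof.
by move=> xs yt; rewrite (le_trans (mxnorm1M _ _)) // ler_pM // mxnorm1_ge0.
Qed.

Lemma mxnorm1_sqrt_remainder d e : mxnorm1 d <= 8^-1 ->
  mxnorm1 e <= mxnorm1 d -> mxnorm1 (sqrt_remainder d e) <= 2 * mxnorm1 d.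
Proof.
move=> d8 ed; have e8 := le_trans ed d8.
have ee := mxnorm1M_le ed e8; have ed8 := mxnorm1M_le ed d8.
have de := mxnorm1M_le (lexx (mxnorm1 d)) e8; have ede := mxnorm1M_le ed8 e8.
rewrite /sqrt_remainder.
apply: (@le_trans _ _ (mxnorm1 d + mxnorm1 d * 8^-1 + mxnorm1 d * 8^-1
    + mxnorm1 d * 8^-1 + mxnorm1 d * 8^-1 * 8^-1)); last first.
  by have := mxnorm1_ge0 d; lra.
by rewrite !mxnorm1D_le.
Qed.

Lemma mxnorm1_sqrt_remainderB d e f : mxnorm1 d <= 8^-1 ->
  mxnorm1 e <= mxnorm1 d -> mxnorm1 f <= mxnorm1 d ->
  mxnorm1 (sqrt_remainder d e - sqrt_remainder d f) <= mxnorm1 (e - f).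
Proof.
move=> d8 ed fd; rewrite sqrt_remainderB.
have e8 := le_trans ed d8; have f8 := le_trans fd d8.
set D := mxnorm1 (e - f); have DD : mxnorm1 (e - f) <= D by [].
apply: (@le_trans _ _ (8^-1 * D + D * 8^-1 + D * 8^-1 + 8^-1 * D
    + 8^-1 * 8^-1 * D + D * 8^-1 * 8^-1)); last first.
  by have : 0 <= D by [exact: mxnorm1_ge0]; lra.
by rewrite !(mxnorm1D_le, mxnorm1M_le).
Qed.

(* Its fixed points e are the solutions of (1 + e) (1 + d) (1 + e) = 1; unlike a
   power series, the iteration visibly preserves self-adjointness without
   requiring that e and d commute. *)
Definition sqrt_step d e := - mxhalf (sqrt_remainder d e).

Lemma inverse_sqrt d : mx_adjoint d = d -> scalar_part d = 0 -> mxnorm1 d <= 8^-1 ->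
  exists e, [/\ mx_adjoint e = e, mxnorm1 e <= mxnorm1 d &
    (1%:M + e) *m (1%:M + d) *m (1%:M + e) = 1%:M].
Proof.
move=> dd d0 d8.
pose x n := iter n (sqrt_step d) 0.
have xd n : mxnorm1 (x n) <= mxnorm1 d.
  elim: n => [|n IH]; last first.
    rewrite /= /sqrt_step mxnorm1N mxnorm1_half ler_pdivrMr // mulrC.
    exact: mxnorm1_sqrt_remainder.
  rewrite /mxnorm1 big1 ?mxnorm1_ge0 // => i _.
  by rewrite big1 // => j _; rewrite mxE unorm0.
have xx n : mx_adjoint (x n) = x n.
  elim: n => [|n IH].
    by apply/matrixP => i j; rewrite !mxE unitization_star0.
  rewrite /= /sqrt_step mx_adjointN mxhalf_adj; congr (- mxhalf _).
  rewrite /sqrt_remainder !mx_adjointD !mx_adjointM -/(x n) IH dd.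
  rewrite mulmxA; congr (_ + _); rewrite -!addrA; congr (_ + (_ + _)).
  exact: addrC.
have x0 n : scalar_part (x n) = 0.
  elim: n => [|n IH]; first by apply/matrixP => i j; rewrite !mxE.
  rewrite /= /sqrt_step scalar_partN scalar_part_half /sqrt_remainder.
  rewrite !(scalar_partD, scalar_partM) -/(x n) IH d0.
  by rewrite !mulmx0 !addr0 scaler0 oppr0.
have step e f : mxnorm1 e <= mxnorm1 d -> mxnorm1 f <= mxnorm1 d ->
    mxnorm1 (sqrt_step d e - sqrt_step d f) <= mxnorm1 (e - f) / 2.
  move=> ed fd; rewrite /sqrt_step -opprD mxnorm1N -mxhalfB mxnorm1_half.
  rewrite ler_pM2r ?invr_gt0 //; exact: mxnorm1_sqrt_remainderB.
have xS n : mxnorm1 (x n.+1 - x n) <= mxnorm1 (x 1%N - x 0%N) * 2^-1 ^+ n.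
  elim: n => [|n IH]; first by rewrite expr0 mulr1.
  rewrite (le_trans (step (x n.+1) (x n) (xd _) (xd _))) //.
  by rewrite exprSr mulrA ler_pM2r ?invr_gt0.
have [e [K eK]] := mxnorm1_cvg_geometric x0 xS.
have ed : mxnorm1 e <= mxnorm1 d.
  apply: (@le_half_exp _ _ _ K) => n.
  have := mxnorm1D (x n) (e - x n); rewrite addrC subrK => /le_trans; apply.
  by rewrite lerD // mxnorm1B.
exists e; split=> //.
  apply/eqP; rewrite -subr_eq0; apply/eqP/mxnorm1_eq0.
  apply: (@le_half_exp _ _ _ (K + K)) => n; rewrite add0r mulrDl.
  have -> : mx_adjoint e - e = mx_adjoint (e - x n) + (x n - e).
    by rewrite mx_adjointD mx_adjointN xx addrA subrK.
  rewrite (le_trans (mxnorm1D _ _)) // mxnorm1_adj lerD //.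
  by rewrite mxnorm1B.
have eE : sqrt_step d e = e.
  apply/eqP; rewrite -subr_eq0; apply/eqP/mxnorm1_eq0.
  apply: (@le_half_exp _ _ _ K) => n; rewrite add0r.
  have -> : sqrt_step d e - e = (sqrt_step d e - x n.+1) + (x n.+1 - e).
    by rewrite addrA subrK.
  rewrite (le_trans (mxnorm1D _ _)) //.
  have := step e (x n) ed (xd n); have := eK n; have := eK n.+1.
  rewrite exprS (mxnorm1B e (x n)) /= => h1 h2 h3.
  lra.
by rewrite sqrt_remainderE -{1 2}eE /sqrt_step -opprD mxhalfK addNr addr0.
Qed.

Lemma stably_finite_defect (w : M) : stably_finite A -> (1 <= r)%N ->
  scalar_part (w *m mx_adjoint w - 1%:M) = 0 ->
  mxnorm1 (w *m mx_adjoint w - 1%:M) <= 8^-1 ->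
  mxnorm1 (mx_adjoint w *m w - 1%:M) <=
    3 * mxnorm1 w ^+ 2 * mxnorm1 (w *m mx_adjoint w - 1%:M).
Proof.
move=> sfA r1; set d := w *m mx_adjoint w - 1%:M => sd d8.
have wE : w *m mx_adjoint w = 1%:M + d by rewrite addrC subrK.
have dd : mx_adjoint d = d.
  by rewrite mx_adjointD mx_adjointN mx_adjoint1 mx_adjointM mx_adjointK.
have [e [ee ed eE]] := inverse_sqrt dd sd d8.
have pp : mx_adjoint (1%:M + e) = 1%:M + e by rewrite mx_adjointD mx_adjoint1 ee.
have := sfA r ((1%:M + e) *m w) r1.
rewrite mx_adjointM pp !mulmxA -(mulmxA _ w) wE eE => /(_ erefl) h.
have -> : mx_adjoint w *m w - 1%:M =
    - (mx_adjoint w *m (e + e + e *m e) *m w).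
  rewrite -h !(mulmxDl, mulmxDr, mulmx1) !addrA !opprD !addrA subrr add0r.
  by rewrite !mulmxA.
rewrite mxnorm1N.
have e1 : mxnorm1 e <= 1.
  by rewrite (le_trans ed) // (le_trans d8) // invf_le1 ?ler1n.
have h3 := mxnorm1M_le (mxnorm1M_le (lexx (mxnorm1 (mx_adjoint w)))
  (mxnorm1D_le (mxnorm1D_le ed ed) (mxnorm1M_le ed e1))) (lexx (mxnorm1 w)).
apply: (le_trans h3); rewrite mxnorm1_adj le_eqVlt; apply/orP; left; apply/eqP.
ring.
Qed.

End InverseSquareRoot.

Section MatrixSections.
Context (R : realType) (T : topologicalType) (F : continuous_field R T) (r : nat).

Definition unitization_section (u : forall t, unitization (fiber F t)) : Prop :=
  exists l : R[i], exists2 x, sections F x & forall t, u t = (l, x t).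

Definition mx_section (W : forall t, 'M[unitization (fiber F t)]_r) : Prop :=
  forall i j, unitization_section (fun t => W t i j).

Lemma unitization_sectionD u v : unitization_section u ->
  unitization_section v -> unitization_section (fun t => u t + v t).
Proof.
move=> [k [x Fx ux]] [l [y Fy vy]]; exists (k + l), (fun t => x t + y t).
  exact: cfieldD (continuous_fieldP F) _ _ Fx Fy.
by move=> t; rewrite ux vy.
Qed.

Lemma unitization_section_cst (k : R[i]) :
  unitization_section (fun t => (k, 0)).
Proof.
by exists k, (fun=> 0) => //; exact: cfield0 (continuous_fieldP F).
Qed.

Lemma unitization_sectionN u : unitization_section u ->
  unitization_section (fun t => - u t).
Proof.
move=> [k [x Fx ux]]; exists (- k), (fun t => -1 *: x t).
  exact: cfieldZ (continuous_fieldP F) _ _ Fx.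
by move=> t; rewrite ux scaleN1r.
Qed.

Lemma unitization_section_star u : unitization_section u ->
  unitization_section (fun t => unitization_star (u t)).
Proof.
move=> [k [x Fx ux]]; exists (conjc k), (fun t => cstar (x t)).
  exact: cfield_star (continuous_fieldP F) _ Fx.
by move=> t; rewrite ux.
Qed.

Lemma unitization_sectionM u v : unitization_section u ->
  unitization_section v -> unitization_section (fun t => u t * v t).
Proof.
have FP := continuous_fieldP F.
move=> [k [x Fx ux]] [l [y Fy vy]]; exists (k * l).
exists (fun t => k *: y t + l *: x t + cmul (x t) (y t)).
  apply: (cfieldD FP); last exact: cfieldM FP _ _ Fx Fy.
  by apply: (cfieldD FP); exact: cfieldZ FP _ _ _.
by move=> t; rewrite ux vy.
Qed.

Lemma unitization_section_sum (I : Type) (s : seq I)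
    (u : I -> forall t, unitization (fiber F t)) :
  (forall i, unitization_section (u i)) ->
  unitization_section (fun t => \sum_(i <- s) u i t).
Proof.
move=> hu; elim: s => [|i s IH].
  have [k [x Fx e]] := unitization_section_cst 0.
  by exists k, x => // t; rewrite big_nil -e.
have [k [x Fx e]] := unitization_sectionD (hu i) IH.
by exists k, x => // t; rewrite big_cons e.
Qed.

Lemma mx_section_cvg_norm W (t : T) : mx_section W ->
  (mxnorm1 (W s) @[s --> t] --> mxnorm1 (W t)).
Proof.
move=> hW; apply: cvg_big; first exact: add_continuous.
move=> i _; apply: cvg_big; first exact: add_continuous.
move=> j _; have [k [x Fx Wx]] := hW i j.
have -> : (fun s => unorm (W s i j)) =
    (fun s => complex.Re `|k| + complex.Re `|x s|).
  by apply/funext => s; rewrite Wx.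
rewrite Wx; apply: cvgD; first exact: cvg_cst.
exact: (cfield_norm (continuous_fieldP F) Fx).
Qed.

Lemma mx_sectionD V W : mx_section V -> mx_section W ->
  mx_section (fun t => V t + W t).
Proof.
move=> hV hW i j; have [k [x Fx e]] := unitization_sectionD (hV i j) (hW i j).
by exists k, x => // t; rewrite mxE e.
Qed.

Lemma mx_sectionN W : mx_section W -> mx_section (fun t => - W t).
Proof.
move=> hW i j; have [k [x Fx e]] := unitization_sectionN (hW i j).
by exists k, x => // t; rewrite mxE e.
Qed.

Lemma mx_section1 : mx_section (fun t => 1%:M).
Proof.
move=> i j; have [k [x Fx e]] := unitization_section_cst ((i == j)%:R).
exists k, x => // t; rewrite mxE -e; by case: (i == j).
Qed.

Lemma mx_section_adj W : mx_section W -> mx_section (fun t => mx_adjoint (W t)).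
Proof.
move=> hW i j; have [k [x Fx e]] := unitization_section_star (hW j i).
by exists k, x => // t; rewrite !mxE e.
Qed.

Lemma mx_sectionM V W : mx_section V -> mx_section W ->
  mx_section (fun t => V t *m W t).
Proof.
move=> hV hW i j.
have [k [x Fx e]] := @unitization_section_sum _ (index_enum 'I_r)
  (fun l t => V t i l * W t l j) (fun l => unitization_sectionM (hV i l) (hW l j)).
by exists k, x => // t; rewrite mxE -e.
Qed.

Lemma mx_section_approx (t : T) (v : 'M[unitization (fiber F t)]_r) (e : R) :
  0 < e -> exists W, [/\ mx_section W, mxnorm1 (W t - v) <= e &
    forall s, scalar_part (W s) = scalar_part v].
Proof.
move=> e0; pose c := e / (r * r).+1%:R.
have c0 : 0 < c by rewrite divr_gt0.
have /choice[x hx] (ij : 'I_r * 'I_r) : exists x, sections F x /\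
    complex.Re `|x t - (v ij.1 ij.2).2| <= c.
  have c0' : 0 < c%:C by rewrite (ltcR 0).
  have := cfield_dense (continuous_fieldP F) (t := t).
  move=> /(_ (ball (v ij.1 ij.2).2 c%:C)) [].
  - by exists (v ij.1 ij.2).2; exact: ballxx.
  - exact: ball_open.
  move=> _ [/[swap] -[x Fx <-]]; rewrite -ball_normE /= distrC => h.
  by exists x; split => //; rewrite -lecR -cnormE ltW.
exists (fun s => \matrix_(i, j) ((v i j).1, x (i, j) s)); split.
- move=> i j; exists (v i j).1, (x (i, j)); first by have [] := hx (i, j).
  by move=> s; rewrite mxE.
- apply: (@le_trans _ _ (\sum_(i < r) \sum_(j < r) c)).
    apply: ler_sum => i _; apply: ler_sum => j _; rewrite !mxE.
    rewrite unorm_scalar_free; first by have [] := hx (i, j).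
    exact: subrr.
  rewrite !sumr_const !card_ord -mulrnA -[_ *+ _]mulr_natr.
  by rewrite mulrAC ler_pdivrMr // ler_pM2l // ler_nat.
- by move=> s; apply/matrixP => i j; rewrite !mxE.
Qed.

End MatrixSections.

Lemma unit_interval_near_gt0 (R : realType) (P : set (unit_interval R)) :
  (\forall t \near unit_interval_zero R, P t) ->
  exists2 t : unit_interval R, 0 < (set_val t : R) & P t.
Proof.
rewrite /prop_near1 nbhsE => -[_ [[U oU <-]] /= U0 UP].
have /nbhs_ballP[e /= e0 eU] : nbhs (0 : R) U by exact: open_nbhs_nbhs.
pose x := Num.min 1 (e / 2).
have x0 : 0 < x by rewrite lt_min ltr01 divr_gt0.
have x01 : x \in (`[0, 1]%classic : set R).
  by rewrite inE /= in_itv /= (ltW x0) ge_min lexx.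
exists (exist _ x x01) => //; apply: UP; apply: eU.
rewrite /= -ball_normE /= sub0r normrN gtr0_norm //.
by rewrite gt_min [e / 2 < e]ltr_pdivrMr // ltr_pMr // ltr1n orbT.
Qed.

Theorem proposition2p18 (R : realType)
    (F : continuous_field R (unit_interval R)) :
  trivial_on F [set t : unit_interval R | 0 < (set_val t : R)] ->
  (forall t : unit_interval R, 0 < (set_val t : R) -> stably_finite (fiber F t)) ->
  stably_finite (fiber F (unit_interval_zero R)).
Proof.
move=> _ sfF r v r1 vv; set t0 := unit_interval_zero R in v vv *.
pose m := mxnorm1 v + 1; have m1 : 1 <= m by rewrite lerDr mxnorm1_ge0.
apply/eqP; rewrite -subr_eq0; apply/eqP/mxnorm1_eq0.
pose K := 2 * m + 1 + 48 * m ^+ 3.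
have K0 : 0 < K.
  by rewrite ltr_wpDr ?mulr_ge0 ?exprn_ge0 ?ltr_wpDl ?mulr_ge0 //;
    rewrite (le_trans ler01).
apply/ler_addgt0Pr => e e0; rewrite add0r.
pose c := Num.min (e / K) (32 * m)^-1.
have m0 : 0 < m by rewrite (lt_le_trans ltr01).
have c0 : 0 < c by rewrite lt_min divr_gt0 // invr_gt0 mulr_gt0.
have cK : c * K <= e by rewrite -ler_pdivlMr // ge_min lexx.
have cm : c * (32 * m) <= 1.
  by rewrite -ler_pdivlMr ?mulr_gt0 // mul1r ge_min lexx orbT.
have c1 : c <= 1 by nra.
have [W [hW Wv sW]] := mx_section_approx v c0.
have hWW : mx_section (fun t => W t *m mx_adjoint (W t) - 1%:M).
  apply: mx_sectionD; first exact: mx_sectionM (mx_section_adj _).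
  by apply: mx_sectionN; exact: mx_section1.
have hWW' : mx_section (fun t => mx_adjoint (W t) *m W t - 1%:M).
  apply: mx_sectionD; first exact: mx_sectionM (mx_section_adj _) _.
  by apply: mx_sectionN; exact: mx_section1.
have near_c (V : forall t, 'M[unitization (fiber F t)]_r) :
    mx_section V -> \forall t \near t0,
    `|mxnorm1 (V t0) - mxnorm1 (V t)| <= c.
  by move=> hV; have /cvgr_dist_le /(_ _ c0) := mx_section_cvg_norm (t := t0) hV.
have [t t_gt0 [[Wt WWt] WWt']] := unit_interval_near_gt0
  (filterI (filterI (near_c _ hW) (near_c _ hWW)) (near_c _ hWW')).
have Wm : mxnorm1 (W t0) <= m.
  have := mxnorm1D (W t0 - v) v; rewrite subrK /m; lra.
have vm : mxnorm1 v <= m by rewrite lerDl.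
have d0 : mxnorm1 (W t0 *m mx_adjoint (W t0) - 1%:M) <= 2 * m * c.
  have -> : W t0 *m mx_adjoint (W t0) - 1%:M =
      (W t0 - v) *m mx_adjoint (W t0) + v *m mx_adjoint (W t0 - v).
    by rewrite mx_adjointD mx_adjointN mulmxBl mulmxBr addrA subrK vv.
  have h1 : mxnorm1 (mx_adjoint (W t0)) <= m by rewrite mxnorm1_adj.
  have h2 : mxnorm1 (mx_adjoint (W t0 - v)) <= c by rewrite mxnorm1_adj.
  have := mxnorm1D_le (mxnorm1M_le Wv h1) (mxnorm1M_le vm h2); lra.
have d0' : mxnorm1 (mx_adjoint v *m v - mx_adjoint (W t0) *m W t0) <= 2 * m * c.
  rewrite mxnorm1B.
  have -> : mx_adjoint (W t0) *m W t0 - mx_adjoint v *m v =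
      mx_adjoint (W t0 - v) *m W t0 + mx_adjoint v *m (W t0 - v).
    by rewrite mx_adjointD mx_adjointN mulmxBl mulmxBr addrA subrK.
  have h1 : mxnorm1 (mx_adjoint v) <= m by rewrite mxnorm1_adj.
  have h2 : mxnorm1 (mx_adjoint (W t0 - v)) <= c by rewrite mxnorm1_adj.
  have := mxnorm1D_le (mxnorm1M_le h2 Wm) (mxnorm1M_le h1 Wv); lra.
move: Wt WWt WWt'; rewrite !ler_distl.
move=> /andP[Wt _] /andP[WWt _] /andP[_ WWt'].
have Wt2 : mxnorm1 (W t) <= 2 * m by lra.
have dt : mxnorm1 (W t *m mx_adjoint (W t) - 1%:M) <= 4 * m * c by nra.
have dt8 : mxnorm1 (W t *m mx_adjoint (W t) - 1%:M) <= 8^-1 by lra.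
have st : scalar_part (W t *m mx_adjoint (W t) - 1%:M) = 0.
  rewrite scalar_partD scalar_partM scalar_part_adj sW -scalar_part_adj.
  by rewrite -scalar_partM vv scalar_partN !scalar_part1 subrr.
have defect : mxnorm1 (mx_adjoint (W t) *m W t - 1%:M) <= 48 * m ^+ 3 * c.
  apply: (le_trans (stably_finite_defect (sfF t t_gt0) r1 st dt8)).
  have -> : 48 * m ^+ 3 * c = 3 * (2 * m) ^+ 2 * (4 * m * c) by ring.
  rewrite ler_pM ?mulr_ge0 ?exprn_ge0 ?mxnorm1_ge0 // ler_pM2l //.
  by rewrite lerXn2r ?nnegrE ?mxnorm1_ge0 // mulr_ge0 // ltW.
have := mxnorm1D_le d0' WWt'; rewrite addrA subrK => h.
by rewrite (le_trans h) // (le_trans _ cK) // /K; lra.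
Qed.
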